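(* For every null set $F\subseteq 2^\omega$ and every Silver tree $T\subseteq 2^{<\omega}$ there is a Silver tree $T'\subseteq T$ such that for every $n\in\omega$ the set $$F+\underbrace{[T']+[T']+\dots+[T']}_{n\text{ times}}$$ is null.
   Context: Null means of measure zero with respect to the standard product (Haar) probability measure on $2^\omega$. A tree is a nonempty set $T\subseteq 2^{<\omega}$ closed under initial segments. Write $\mathrm{split}(T)=\{\sigma\in T:\sigma^\frown 0\in T\text{ and }\sigma^\frown 1\in T\}$ and $[T]=\{x\in 2^\omega:(\forall n\in\omega)\ x\upharpoonright n\in T\}$. $T$ is perfect if for every $\sigma\in T$ there is $\tau\in\mathrm{split}(T)$ with $\sigma\subseteq\tau$. $T$ is a Silver tree if it is perfect and for all $\sigma,\tau\in T$ with $|\sigma|=|\tau|$ and all $i\in\{0,1\}$: $\sigma^\frown i\in T\iff\tau^\frown i\in T$. On $2^\omega$, $+$ is coordinatewise addition modulo $2$, and $A+B=\{a+b:a\in A,\ b\in B\}$ for $A,B\subseteq 2^\omega$; for $n=0$ the displayed set is read as $F$ itself. *)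

(* Defs.v *)
(* MathComp / MathComp-Analysis. *)
From HB Require Import structures.
From mathcomp Require Import all_boot all_order all_algebra finmap.
From mathcomp Require Import all_classical all_reals all_analysis.
From mathcomp Require Import ring.

Set Implicit Arguments.
Unset Strict Implicit.
Unset Printing Implicit Defensive.

Import Order.TTheory GRing.Theory Num.Theory.
Import numFieldNormedType.Exports.

Local Open Scope classical_set_scope.
Local Open Scope ring_scope.

Definition cylinder (s : seq bool) : set cantor_space :=
  [set x | mkseq x (size s) = s].

(* The sets depending on the first [n] coordinates only; for varying [n] they
   are the finite unions of cylinders. *)
Definition determined (n : nat) (A : set cantor_space) : Prop :=
  forall x y : cantor_space, (forall i, (i < n)%N -> x i = y i) -> A x -> A y.

Definition clopen_algebra : set (set cantor_space) :=
  [set A | exists n, determined n A].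

Lemma determinedW m n A : (m <= n)%N -> determined m A -> determined n A.
Proof. by move=> mn dA x y xy; apply: dA => i im; apply/xy/(leq_trans im). Qed.

Lemma clopen_algebra0 : clopen_algebra set0.
Proof. by exists 0%N. Qed.

Lemma clopen_algebraU : setU_closed clopen_algebra.
Proof.
move=> A B [m dA] [n dB]; exists (maxn m n) => x y xy [Ax|Bx].
- by left; apply: (determinedW (leq_maxl m n) dA) Ax.
- by right; apply: (determinedW (leq_maxr m n) dB) Bx.
Qed.

Lemma clopen_algebraC : setC_closed clopen_algebra.
Proof.
move=> A [n dA]; exists n => x y xy /= nAx Ay; apply: nAx.
by apply: dA Ay => i /xy.
Qed.

Fact clopen_display : measure_display. Proof. by []. Qed.

HB.instance Definition _ := @isAlgebraOfSets.Build clopen_display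
  cantor_space clopen_algebra clopen_algebra0 clopen_algebraU clopen_algebraC.

(* Its measurable sets form the sigma-algebra generated by the cylinders, that
   is, the Borel (product) sigma-algebra. *)
Notation borel_cantor :=
  (g_sigma_algebraType (@measurable _ cantor_space)).

Definition zero_ext (s : seq bool) : cantor_space := fun i => nth false s i.

Section coin_content.
Variable R : realType.

Definition proportion (n : nat) (A : set cantor_space) : R :=
  #|[pred s : n.-tuple bool | `[< A (zero_ext s) >]]|%:R / 2 ^+ n.

(* For a set in [clopen_algebra] the sequence is eventually constant. *)
Definition coin_content (A : set cantor_space) : \bar R :=
  limn (fun n => (proportion n A)%:E).

Lemma proportionS n A : determined n A -> proportion n.+1 A = proportion n A.
Proof.
move=> dA; rewrite /proportion exprS invfM mulrCA mulrC -[RHS]mul1r mulrC.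
suff -> : #|[pred s : n.+1.-tuple bool | `[< A (zero_ext s) >]]| =
    (2 * #|[pred s : n.-tuple bool | `[< A (zero_ext s) >]]|)%N.
  rewrite natrM; field.
  by rewrite expf_neq0.
have ext_rcons (s : n.-tuple bool) b :
    `[< A (zero_ext (rcons s b)) >] = `[< A (zero_ext s) >].
  apply: asbool_equiv_eq; split; apply: dA => i ni;
  by rewrite /zero_ext nth_rcons size_tuple ni.
rewrite -!sum1_card.
pose h (p : bool * n.-tuple bool) : n.+1.-tuple bool := [tuple of rcons p.2 p.1].
pose g (s : n.+1.-tuple bool) : bool * n.-tuple bool :=
  (last false s, [tuple of belast (thead s) (behead s)]).
have hg : cancel h g.
  move=> [b s]; rewrite /h /g; congr pair; first by rewrite /= last_rcons.
  apply: val_inj => /=; rewrite /thead (tnth_nth false) /=.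
  case: (tval s) => [|x s'] //=.
  by rewrite belast_rcons.
have hb : bijective h.
  apply: inj_card_bij; first exact: can_inj hg.
  by rewrite card_prod !card_tuple card_bool expnS.
rewrite (reindex h) /=; last by apply: onW_bij.
rewrite (eq_bigl (fun p : bool * n.-tuple bool =>
    xpredT p.1 && `[< A (zero_ext p.2) >])); last first.
  by move=> p; rewrite unfold_in /= ext_rcons.
rewrite -(pair_big xpredT (fun s : n.-tuple bool => `[< A (zero_ext s) >])
  (fun _ _ => 1%N)) /=.
by rewrite big_const card_bool iter_addn_0 mulnC.
Qed.

Lemma coin_contentE n A : determined n A ->
  coin_content A = (proportion n A)%:E.
Proof.
move=> dA; apply/cvg_lim => //; apply: cvg_near_cst.
exists n => // m /= nm; congr _%:E.
rewrite -(subnKC nm); elim: (m - n)%N => [|k IH]; first by rewrite addn0.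
rewrite addnS proportionS//; apply: determinedW dA; exact: leq_addr.
Qed.

Lemma proportion_ge0 n A : 0 <= proportion n A.
Proof. by rewrite divr_ge0// exprn_ge0. Qed.

Lemma coin_content_ge0 A : (0 <= coin_content A)%E.
Proof.
have [cv|dv] := pselect (cvgn (fun n => (proportion n A)%:E)); last first.
  by rewrite /coin_content dvgP.
by apply: lime_ge => //; apply: nearW => n; rewrite lee_fin proportion_ge0.
Qed.

Lemma coin_content0 : coin_content set0 = 0%E.
Proof.
rewrite (@coin_contentE 0)// /proportion.
rewrite eq_card0 ?mul0r// => s; rewrite !inE.
by apply/asboolP.
Qed.

Lemma coin_content_additive : measure_function.semi_additive coin_content.
Proof.
apply/(additive2P coin_content0) => A B [m dA] [n dB] AB0.
pose k := maxn m n.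
have {}dA : determined k A by apply: determinedW dA; exact: leq_maxl.
have {}dB : determined k B by apply: determinedW dB; exact: leq_maxr.
rewrite !(@coin_contentE k)//; last first.
  by move=> x y xy [Ax|Bx]; [left; apply: dA Ax|right; apply: dB Bx].
rewrite -EFinD -mulrDl -natrD; congr (_%:R / _)%:E.
rewrite -cardUI [X in (_ + X)%N](_ : _ = 0)%N ?addn0.
  apply: eq_card => s; rewrite !inE.
  by apply/asboolP/orP => -[/asboolP|/asboolP] H; [left|right|left|right].
apply: eq_card0 => s; rewrite !inE.
apply/negP => /andP[/asboolP As /asboolP Bs].
by have : (A `&` B) (zero_ext s) by []; rewrite AB0.
Qed.

HB.instance Definition _ := isContent.Build _ _ _ coin_content
  coin_content_ge0 coin_content_additive.

Lemma determined_open n A : determined n A -> open A.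
Proof.
move=> dA; rewrite openE => x Ax; rewrite /interior.
have agree : \forall y \near x, forall i, (i < n)%N -> x i = y i.
  elim: n {dA} => [|n IH]; first by near=> z => ?; rewrite ltn0.
  near=> z => i; rewrite leq_eqVlt => /predU1P[|iSn]; last by rewrite (near IH z).
  move=> [->]; near: z; exists (proj n @^-1` [set x n]).
  split => //; suff : @open cantor_space (proj n @^-1` [set x n]) by [].
  by apply: open_comp; [move=> + _; exact: proj_continuous|exact: discrete_open].
by apply: filterS agree => y xy; apply: dA Ax.
Unshelve. all: by end_near. Qed.

Lemma coin_content_sigma_subadditive :
  measurable_subset_sigma_subadditive coin_content.
Proof.
move=> A F mF mA AF.
have [n AFn] : exists n, A `<=` \bigcup_(i < n) F i.
  have cA : compact A.
    apply: (subclosed_compact _ cantor_space_compact) => //.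
    have [n dA] := clopen_algebraC mA.
    by rewrite -[A]setCK closedC; apply: determined_open dA.
  rewrite compact_cover in cA.
  have [|//|D _ AD] := cA nat setT F.
    by move=> i _; have [n dF] := mF i; apply: determined_open dF.
  exists (\max_(i <- D) i).+1 => x /AD[i /= iD Fix]; exists i => //=.
  by rewrite ltnS; apply: (leq_bigmax_seq (F := id)).
apply: (@le_trans _ _ (\sum_(i < n) coin_content (F i))%E).
  by apply: content_subadditive => //; rewrite -bigcup_mkord.
rewrite -(big_mkord xpredT (fun i => coin_content (F i))).
by apply: nneseries_lim_ge => i _ _; exact: coin_content_ge0.
Qed.

HB.instance Definition _ := Content_SigmaSubAdditive_isMeasure.Build _ _ _
  coin_content coin_content_sigma_subadditive.

Definition coin_measure : set borel_cantor -> \bar R :=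
  measure_extension coin_content.

HB.instance Definition _ := Measure.on coin_measure.

Lemma coin_measure_clopen n A : determined n A ->
  coin_measure A = (proportion n A)%:E.
Proof.
move=> dA; rewrite /coin_measure /measure_extension measurable_mu_extE.
- exact: coin_contentE.
- by exists n.
Qed.

Lemma determined_cylinder s : determined (size s) (cylinder s).
Proof.
move=> x y xy xs; rewrite /cylinder /= -[RHS]xs; apply/eq_in_map => i.
by rewrite mem_iota => /andP[_ ni]; rewrite xy.
Qed.

Lemma coin_measure_cylinder s : coin_measure (cylinder s) = (2 ^- size s)%:E.
Proof.
rewrite (coin_measure_clopen (@determined_cylinder s)); congr _%:E.
rewrite /proportion -[RHS]mul1r; congr (_ / _).
rewrite (eq_card (B := pred1 (in_tuple s))) ?card1// => t.
rewrite !inE; apply/asboolP/eqP => [|->].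
- move=> ts; apply: val_inj => /=; rewrite -[RHS]ts.
  have := mkseq_nth false t; rewrite size_tuple => tE.
  exact: esym tE.
- by rewrite /cylinder /= mkseq_nth.
Qed.

Lemma coin_measureT : coin_measure setT = 1%E.
Proof.
rewrite (_ : setT = cylinder [::]); last by apply/seteqP; split.
by rewrite coin_measure_cylinder expr0 invr1.
Qed.

HB.instance Definition _ :=
  Measure_isProbability.Build _ _ _ coin_measure coin_measureT.

(* [F] need not be Borel: null for the completed measure. *)
Definition coin_null (F : set cantor_space) : Prop := coin_measure.-negligible F.

End coin_content.

Definition tree (T : set (seq bool)) : Prop :=
  T !=set0 /\ forall s t, prefix s t -> T t -> T s.

Definition split_nodes (T : set (seq bool)) : set (seq bool) :=
  [set s | [/\ T s, T (rcons s false) & T (rcons s true)]].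

Definition body (T : set (seq bool)) : set cantor_space :=
  [set x | forall n, T (mkseq x n)].

Definition perfect_tree (T : set (seq bool)) : Prop :=
  forall s, T s -> exists2 t, split_nodes T t & prefix s t.

Definition silver_tree (T : set (seq bool)) : Prop :=
  [/\ tree T, perfect_tree T &
    forall s t i, T s -> T t -> size s = size t ->
      (T (rcons s i) <-> T (rcons t i))].

Definition cantor_add (x y : cantor_space) : cantor_space :=
  fun n => x n (+) y n.

Definition sumset (A B : set cantor_space) : set cantor_space :=
  [set cantor_add a b | a in A & b in B].

(* F + B + ... + B with [n] summands [B]. *)
Definition add_times (F B : set cantor_space) (n : nat) : set cantor_space :=
  iter n (fun A => sumset A B) F.

(* Main.v *)
Require Import Defs.
From mathcomp Require Import all_boot all_order all_algebra.
From mathcomp Require Import all_classical all_reals all_analysis.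

Import Order.TTheory GRing.Theory Num.Theory.
Local Open Scope classical_set_scope.

(** Two observations carry the proof.

    The first is algebraic.  A Silver tree decides each level in the same way
    at all of its nodes, so thinning it out to a set [A] of split levels and
    fixing the other levels as along a branch [z] gives a tree whose body is
    the coset [z + P], where [P] is the subgroup of points supported in [A].
    Hence the [n]-fold sumset of the body lies in the coset [n z + P], and it
    is enough to choose [A] such that [F + c + P] is null for every [c].

    The second is a count.  If [D] depends on the first [k] coordinates and
    [A] has at most [w] elements below [k], then only [2 ^ w] patterns of
    length [k] occur in [c + P], so [D + c + P] again depends on the first [k]
    coordinates and has measure at most [2 ^ w] times that of [D]
    ([proportion_sumset]).  A null set [F] is contained in the upper limit of
    sets [E i] of measure at most [4 ^ - i], each depending on the first [k i]
    coordinates only ([null_limsup_blocks]).  The elements [a 0, a 1, ...] of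
    [A] are taken among the infinitely many split levels of the given tree so
    large that only [a 0, ..., a (i - 1)] can lie below [k i].  Then
    [E i + c + P] has measure at most [2 ^ i * 4 ^ - i = 2 ^ - i], and since
    [F + c + P] lies in the upper limit of these sets, it is null by the
    Borel-Cantelli lemma ([coin_null_sumset_coset]). *)

(** * Silver trees and cosets *)

(** The coset [z + P] of the subgroup [P] of points supported in [A]. *)
Definition coset (A : set nat) (z : cantor_space) : set cantor_space :=
  [set x | forall i, A i \/ x i = z i].

Definition silver_of (A : set nat) (z : cantor_space) : set (seq bool) :=
  [set s | forall i, (i < size s)%N -> A i \/ nth false s i = z i].

Definition unbounded (A : set nat) : Prop :=
  forall n, exists2 m, (n <= m)%N & A m.

Lemma silver_of_prefix A z s t :
  prefix s t -> silver_of A z t -> silver_of A z s.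
Proof.
move=> /prefixP[u ->] Tsu i si; have := Tsu i; rewrite nth_cat si size_cat.
by apply; exact: ltn_addr.
Qed.

Lemma silver_of_rcons A z s b :
  silver_of A z (rcons s b) <->
  silver_of A z s /\ (A (size s) \/ b = z (size s)).
Proof.
split=> [Tsb|[Ts Ab] i].
  split; first by apply: silver_of_prefix Tsb; rewrite prefix_rcons.
  by have := Tsb (size s); rewrite size_rcons nth_rcons ltnn eqxx; exact.
rewrite size_rcons ltnS leq_eqVlt nth_rcons => /predU1P[->|is_].
  by rewrite ltnn eqxx.
by rewrite is_; exact: Ts.
Qed.

Lemma silver_of_extend A z s n : silver_of A z s -> (size s <= n)%N ->
  exists t, [/\ silver_of A z t, prefix s t & size t = n].
Proof.
move=> Ts; elim: n => [|n IH].
  by rewrite leqn0 => /eqP s0; exists s; split=> //; exact: prefix_refl.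
rewrite leq_eqVlt => /predU1P[sn|/IH[t [Tt st tn]]].
  by exists s; split=> //; exact: prefix_refl.
exists (rcons t (z n)); split.
- by apply/silver_of_rcons; split=> //; right; rewrite tn.
- by apply: prefix_trans st _; rewrite prefix_rcons.
- by rewrite size_rcons tn.
Qed.

Lemma silver_tree_silver_of A z : unbounded A -> silver_tree (silver_of A z).
Proof.
move=> Ainf; split.
- by split; [exists [::]|move=> s t; exact: silver_of_prefix].
- move=> s Ts; have [n sn An] := Ainf (size s).
  have [t [Tt st tn]] := silver_of_extend _ _ _ _ Ts sn.
  exists t => //; split=> //; apply/silver_of_rcons; rewrite tn;
  by split=> //; left.
- by move=> s t b Ts Tt st; rewrite !silver_of_rcons st; tauto.
Qed.

Lemma body_silver_of A z : body (silver_of A z) `<=` coset A z.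
Proof.
by move=> x Tx i; have := Tx i.+1 i; rewrite size_mkseq nth_mkseq//; exact.
Qed.

Definition split_levels (T : set (seq bool)) : set nat :=
  [set size s | s in split_nodes T].

(** Above any node of a perfect tree there is a split node, and a successor of
    that node is one level higher. *)
Lemma unbounded_split_levels T : silver_tree T -> unbounded (split_levels T).
Proof.
move=> [[[s Ts] _] perfT _]; elim=> [|n [m nm [t [_ _ Tt1] tm]]].
  by have [t Tt _] := perfT s Ts; exists (size t) => //; exists t.
have [u Tu /size_prefix] := perfT _ Tt1; rewrite size_rcons tm => mu.
by exists (size u); [exact: leq_ltn_trans mu|exists u].
Qed.

Lemma silver_tree_level T n : silver_tree T ->
  exists b s, [/\ T s, size s = n & T (rcons s b)].
Proof.
move=> ST; have [m nm [t [Tt _ _] tm]] := unbounded_split_levels T ST n.+1.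
rewrite -tm in nm; case: ST => -[_ preT] _ _.
exists (nth false t n), (take n t); split; [|exact: size_takel (ltnW nm)|].
- exact: preT (prefix_take _ _) Tt.
- by rewrite -(take_nth false nm); exact: preT (prefix_take _ _) Tt.
Qed.

(** Such a [z] is a branch: at each level it takes a value that some node, and
    hence every node, of [T] admits.  At a split level both values are
    admitted, so leaving [z] there does not leave [T]. *)
Lemma silver_tree_branch T : silver_tree T -> exists z : cantor_space,
  forall A, A `<=` split_levels T -> silver_of A z `<=` T.
Proof.
move=> ST; have [z zT] := choice (fun n => silver_tree_level T n ST).
exists z => A AT s; case: (ST) => -[[s0 Ts0] preT] _ homT.
elim/last_ind: s => [_|s b IH].
  by apply: preT Ts0; exact: prefix0s.
move=> /silver_of_rcons[/IH Ts [/AT[t [Tt Tt0 Tt1] ts]|->]].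
  by apply/(homT t s b) => //; case: b.
have [t [Tt ts Ttz]] := zT (size s).
by apply/(homT t s _).
Qed.

(** The subgroup of points supported in [A] absorbs all but the [n]-fold
    multiple of [z], which over the integers modulo 2 is [0] or [z]. *)
Lemma add_times_coset F A z n :
  add_times F (coset A z) n `<=` sumset F (coset A (fun i => odd n && z i)).
Proof.
elim: n => [|n IH] x /=.
  move=> Fx; exists x => //; exists (fun=> false); first by move=> i; right.
  by apply/funext => i; rewrite /cantor_add addbF.
move=> [y /IH[f Ff [q Aq <-]] [p Ap <-]].
exists f => //; exists (cantor_add q p).
  move=> i; case: (Aq i) => [|qi]; first by left.
  case: (Ap i) => [|pi]; [by left|right].
  by rewrite /cantor_add qi pi; case: (odd n); case: (z i).
by apply/funext => i; rewrite /cantor_add addbA.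
Qed.

Lemma add_timesS F A B n : A `<=` B -> add_times F A n `<=` add_times F B n.
Proof.
move=> AB; elim: n => //= n IH _ [x /IH Fx [y /AB By <-]].
by exists x => //; exists y.
Qed.

(** * Sumsets of clopen sets *)

(** If [x = d + q] and [y] agrees with [x] on the first [k] coordinates, then
    [y = (y + q) + q], where [y + q] agrees there with [d]. *)
Lemma determined_sumset k D Q : determined k D -> determined k (sumset D Q).
Proof.
move=> dD x y xy [d Dd [q Qq dq]]; exists (cantor_add y q).
  apply: dD Dd => i ik; rewrite /cantor_add -xy// -dq /cantor_add.
  by rewrite -addbA addbb addbF.
by exists q => //; apply/funext => i; rewrite /cantor_add -addbA addbb addbF.
Qed.

(** The first [k] coordinates of [d + q] are determined by those of [d] and by
    the values of [q] at the [w] positions [a j], since [q] agrees with [c]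
    elsewhere. *)
Lemma proportion_sumset (R : realType) k w (a : 'I_w -> nat) c D Q :
  determined k D ->
  (forall q, Q q -> forall i, (i < k)%N -> (exists j, i = a j) \/ q i = c i) ->
  (proportion R k (sumset D Q) <= 2 ^+ w * proportion R k D)%R.
Proof.
move=> dD Qa; rewrite /proportion mulrA ler_wpM2r ?invr_ge0 ?exprn_ge0//.
rewrite -natrX -natrM ler_nat.
pose q (b : w.-tuple bool) (i : nat) : bool :=
  if [pick j | a j == i] is Some j then tnth b j else c i.
pose h (p : w.-tuple bool * k.-tuple bool) : k.-tuple bool :=
  [tuple tnth p.2 i (+) q p.1 i | i < k].
(* The conjunct [true] puts [B] in the form of a product, as [cardX] needs. *)
pose B := [pred p : w.-tuple bool * k.-tuple bool |
  true && `[< D (zero_ext p.2) >]].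
have -> :
    (2 ^ w * #|[pred s : k.-tuple bool | `[< D (zero_ext s) >]]| = #|B|)%N.
  rewrite -[2%N]card_bool -card_tuple -cardX.
  by apply: eq_card => -[b s].
apply: leq_trans (leq_image_card h B).
apply/subset_leq_card/fintype.subsetP => s /asboolP[d Dd [p Qp dps]].
pose b := [tuple p (a j) | j < w].
suff -> : s = h (b, [tuple d i | i < k]).
  apply: fintype.image_f; apply/asboolP; apply: dD Dd => i ik.
  by rewrite /zero_ext -(tnth_nth _ _ (Ordinal ik)) tnth_mktuple.
apply: eq_from_tnth => i; rewrite !tnth_mktuple /=.
have <- : zero_ext s i = tnth s i by rewrite (tnth_nth false).
rewrite -dps /cantor_add; congr addb; rewrite /q.
case: pickP => [j /eqP aj|noj]; first by rewrite tnth_mktuple aj.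
by case: (Qa p Qp i (ltn_ord i)) => // -[j ij]; have := noj j; rewrite ij eqxx.
Qed.

(** * Null sets as upper limits of clopen sets *)

Lemma measurable_clopen n A :
  determined n A -> measurable (A : set borel_cantor).
Proof. by move=> dA; apply: sub_sigma_algebra; exists n. Qed.

(** A converse of the Borel-Cantelli lemma.  Being null, [F] has for each [i] a
    countable clopen cover of total measure at most [2 ^ - i.+1]; all these
    covers together form a sequence of finite total measure, in which every
    point of [F] is covered at least once for each [i]. *)
Lemma null_limsup_clopen (R : realType) F : coin_null R F ->
  exists D : (set cantor_space)^nat, [/\ forall n, clopen_algebra (D n),
    (\sum_(n <oo) coin_measure R (D n) < +oo)%E & F `<=` lim_sup_set D].
Proof.
move=> [B [_ B0 FB]].
have cover i : exists C : (set cantor_space)^nat,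
    [/\ forall n, clopen_algebra (C n), F `<=` \bigcup_n C n &
      (\sum_(n <oo) coin_measure R (C n) <= (1 / (2 ^ i.+1)%:R)%:E)%E].
  have : (coin_measure R B < (1 / (2 ^ i.+1)%:R)%:E)%E.
    by rewrite B0 lte_fin divr_gt0// ltr0n expn_gt0.
  move=> /ereal_inf_lt[_ [C [clC BC] <-] Ci]; exists C; split=> //.
    exact: subset_trans FB BC.
  apply: le_trans (ltW Ci); rewrite le_eqVlt; apply/orP; left; apply/eqP.
  apply: eq_eseriesr => j _; have [k dk] := clC j.
  by rewrite (coin_measure_clopen R dk) -(coin_contentE R dk).
have [C CP] := choice cover.
have /card_esym/ppcard_eqP[f] := card_nat2.
exists (fun n => C (f n).1 (f n).2); split.
- by move=> n; have [+ _ _] := CP (f n).1; exact.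
- pose g (p : nat * nat) := coin_measure R (C p.1 p.2).
  rewrite nneseries_esumT// -(@reindex_esum _ _ _ setT setT f g)//.
  have -> : [set: nat * nat] = [set: nat] `*`` (fun=> setT).
    by apply/seteqP; split.
  rewrite -(esum_esum (a := fun i j => g (i, j)))// -nneseries_esumT; last first.
    by move=> n; exact: esum_ge0.
  apply: (@le_lt_trans _ _ 1%E); last exact: ltry.
  apply: le_trans (epsilon_trick0 xpredT ler01).
  apply: lee_nneseries => n _; first by move=> _; exact: esum_ge0.
  by rewrite -nneseries_esumT//; have [] := CP n.
- move=> x Fx; have xC i : exists n, C i n x.
    by have [_ /(_ x Fx)[n _ ?] _] := CP i; exists n.
  have [m mC] := choice xC; move=> n _.
  pose u i := f^-1%FUN (i, m i).
  have fu i : f (u i) = (i, m i) by rewrite /u invK ?inE.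
  have [i ni] : exists i, (n < u i)%N.
    by apply: injective_gtn => i j ij; have := fu i; rewrite ij fu => -[].
  by exists (u i); [exact: ltnW|rewrite fu; exact: mC].
Qed.

(** Finite unions of consecutive terms of the sequence above, cut at indices
    [N i] beyond which the terms have total measure less than [4 ^ - i]. *)
Lemma null_limsup_blocks (R : realType) F : coin_null R F ->
  exists (E : (set cantor_space)^nat) (k : nat -> nat),
  [/\ forall i, determined (k i) (E i),
      forall i, (proportion R (k i) (E i) <= 4 ^- i)%R & F `<=` lim_sup_set E].
Proof.
move=> /null_limsup_clopen[D [clD sumD FD]].
have mD n : measurable (D n : set borel_cantor).
  by have [k] := clD n; exact: measurable_clopen.
have thr i : exists t, forall m, (t <= m)%N ->
    (\sum_(m <= n <oo) coin_measure R (D n) < (4 ^- i)%:E)%E.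
  have : (\sum_(N <= n <oo) coin_measure R (D n))%E @[N --> \oo] --> 0%E.
    exact: nneseries_tail_cvg.
  move=> /(_ [set y | (y < (4 ^- i)%:E)%E])[|t _ tP].
    by apply: open_ereal_lt'; rewrite lte_fin invr_gt0 exprn_gt0.
  by exists t => m tm; exact: tP.
have [t tP] := choice thr.
(* Summing the thresholds makes [N] strictly increasing. *)
pose N i := (\sum_(j < i.+1) (t j).+1)%N.
have tN i : (t i <= N i)%N by rewrite /N big_ord_recr /= addnS leqW// leq_addl.
have N_lt i : (N i < N i.+1)%N.
  by rewrite [N i.+1]/N big_ord_recr /= -/(N i) addnS ltnS leq_addr.
have iN i : (i <= N i)%N.
  by elim: i => // i IH; exact: leq_ltn_trans (N_lt i).
pose E i := \big[setU/set0]_(N i <= n < N i.+1) D n.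
have clE i : clopen_algebra (E i).
  apply: (@bigsetU_measurable clopen_display cantor_space) => n _; exact: clD.
have [k dk] := choice clE; exists E, k; split=> //.
  move=> i; rewrite -lee_fin -coin_measure_clopen//.
  apply: le_trans (ltW (tP i _ (tN i))).
  apply: measure_sigma_subadditive_tail => //.
    exact: measurable_clopen (dk i).
  rewrite /E -bigcup_seq => x [n /=]; rewrite mem_index_iota => /andP[Nn _] Dnx.
  by exists n => //=; rewrite ltnNge Nn.
move=> x /FD Dx m _.
(* A term of index at least [N m] lies in the last block [i] with [N i <= n]. *)
have [n Nn Dnx] := Dx (N m) I.
have ex_i : exists i, (N i <= n)%N by exists m.
have bnd i : (N i <= n)%N -> (i <= n)%N by exact: leq_trans.
case: (ex_maxnP ex_i bnd) => i Nin maxi; exists i => /=; first exact: maxi.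
rewrite /E -bigcup_seq; exists n => //=; rewrite mem_index_iota Nin /=.
by rewrite ltnNge; apply/negP => /maxi; rewrite ltnn.
Qed.

(** * Thinning out the split levels *)

(** The set [A'] does not depend on [c], so it serves all the cosets [n z + P]
    at once. *)
Lemma coin_null_sumset_coset (R : realType) F A :
  coin_null R F -> unbounded A -> exists A', [/\ A' `<=` A, unbounded A' &
    forall c, coin_null R (sumset F (coset A' c))].
Proof.
move=> /null_limsup_blocks[E [k [dE Ele FE]]] Ainf.
(* [i <= a i] makes the range of [a] unbounded, and the sum bounds from above
   every [k j] with [j <= i]. *)
have ex_a i : exists m, (i + \sum_(j < i.+1) k j <= m)%N /\ A m.
  by have [m im Am] := Ainf (i + \sum_(j < i.+1) k j)%N; exists m.
have [a aP] := choice ex_a.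
have ka i j : (i <= j)%N -> (k i <= a j)%N.
  move=> ij; apply: leq_trans (aP j).1; apply: leq_trans (leq_addl _ _).
  by rewrite (bigD1 (Ordinal (ij : (i < j.+1)%N))) //= leq_addr.
exists (range a); split.
- by move=> _ [i _ <-]; exact: (aP i).2.
- move=> n; exists (a n); last by exists n.
  exact: leq_trans (leq_addr _ _) (aP n).1.
move=> c; pose G i := sumset (E i) (coset (range a) c).
have dG i : determined (k i) (G i) by exact: determined_sumset.
have mG i : measurable (G i : set borel_cantor).
  exact: measurable_clopen (dG i).
apply: (@negligibleS _ borel_cantor _ _ (lim_sup_set G)).
  move=> _ [f Ff [q Aq <-]] n _; have [i ni Eif] := FE f Ff n I.
  by exists i => //; exists f => //; exists q.
apply/negligibleP.
  by apply: bigcap_measurable => // n _; exact: bigcup_measurable.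
apply: lim_sup_set_cvg0 => //.
apply: (@le_lt_trans _ _ 2%:E); last exact: ltry.
apply: le_trans (epsilon_trick0 xpredT (ler0n R 2)).
apply: lee_nneseries => i _; first by rewrite measure_ge0.
rewrite [leLHS](coin_measure_clopen R (dG i)) lee_fin.
apply: (@le_trans _ _ (2 ^+ i * proportion R (k i) (E i))%R).
  apply: (@proportion_sumset _ _ _ (a \o val) c) => // q Aq j jk.
  case: (Aq j) => [[l _ lj]|]; last by right.
  have li : (l < i)%N.
    by rewrite ltnNge; apply/negP => /ka; rewrite lj leqNgt jk.
  by left; exists (Ordinal li).
apply: le_trans (ler_wpM2l _ (Ele i)) _; first exact: exprn_ge0.
rewrite expnS natrM invfM mulrA divff ?mul1r ?pnatr_eq0// natrX.
have -> : (4 = 2 * 2 :> R)%R by rewrite -natrM.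
by rewrite exprMn invfM mulrA divff ?mul1r ?expf_neq0 ?pnatr_eq0.
Qed.

Theorem theorem10 (R : realType) (F : set cantor_space) (T : set (seq bool)) :
  coin_null R F -> silver_tree T ->
  exists T' : set (seq bool),
    [/\ silver_tree T', T' `<=` T &
        forall n : nat, coin_null R (add_times F (body T') n)].
Proof.
move=> F0 ST; have [z zT] := silver_tree_branch T ST.
have [A [AT Ainf FA0]] :=
  coin_null_sumset_coset R F _ F0 (unbounded_split_levels T ST).
exists (silver_of A z); split; [exact: silver_tree_silver_of|exact: zT|] => n.
apply: negligibleS (FA0 (fun i => odd n && z i)).
apply: subset_trans (add_times_coset F A z n).
exact: add_timesS (@body_silver_of A z).
Qed.
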